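(* (Soundness of D.LL.) Every rule of the calculus D.LL is sound with respect to heterogeneous algebras. That is, for every rule of D.LL, every heterogeneous algebra $(\mathbb{L},\mathbb{D},\mathbb{E},e_\ell,\gamma,e_r,\iota)$, and every assignment of elements of $\mathbb{L}$, $\mathbb{D}$, $\mathbb{E}$ to the atomic propositions and to the (structure and formula) metavariables of type $\mathsf{L}$, $\mathsf{P}$, $\mathsf{P}^{\mathrm{op}}$, respectively, occurring in the rule: if all the inequalities interpreting the premises of the rule hold, then the inequality interpreting its conclusion holds. (For a double-line rule this is required in both directions; for a rule with no premises it means that the conclusion holds.)
   Context: **Heterogeneous algebras.** A heterogeneous algebra is a tuple $(\mathbb{L},\mathbb{D},\mathbb{E},e_\ell,\gamma,e_r,\iota)$ such that: $\mathbb{L}=(L,\le)$ is a bounded poset (with top $\top$ and bottom $\bot$); $\mathbb{D}=(D,\cap,\cup,\wp,\varnothing)$ and $\mathbb{E}=(E,\sqcap,\sqcup,\Im,\emptyset)$ are complete and completely distributive lattices (with tops $\wp$, $\Im$ and bottoms $\varnothing$, $\emptyset$); $\gamma:\mathbb{D}\to\mathbb{L}$ and $e_\ell:\mathbb{L}\to\mathbb{D}$ satisfy $\gamma\dashv e_\ell$ (i.e. $\gamma(\alpha)\le a$ iff $\alpha\le e_\ell(a)$) and $\gamma\circ e_\ell=\mathrm{Id}_{\mathbb{L}}$; $\iota:\mathbb{E}\to\mathbb{L}$ and $e_r:\mathbb{L}\to\mathbb{E}$ satisfy $e_r\dashv\iota$ (i.e. $e_r(a)\le\xi$ iff $a\le\iota(\xi)$)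 and $\iota\circ e_r=\mathrm{Id}_{\mathbb{L}}$. **Language of D.LL** over a set $\mathsf{AtProp}$ of atomic propositions $p$. There are three types $\mathsf{L}$ (Lattice), $\mathsf{P}$ (Left), $\mathsf{P}^{\mathrm{op}}$ (Right), each with formulas and structures. - Type $\mathsf{L}$: formulas $A::=p\mid\top\mid\bot\mid ◆\alpha\mid\blacksquare\xi$; structures $X::=A\mid \mathrm{I}\mid\bullet\Gamma\mid\bullet\Pi$. - Type $\mathsf{P}$: formulas $\alpha::=\Box A\mid\alpha\cap\alpha\mid\alpha\cup\alpha$; structures $\Gamma::=\alpha\mid\circ X\mid\circledS\mid\Gamma\cdot\Gamma\mid\Gamma\supset\Gamma$. - Type $\mathsf{P}^{\mathrm{op}}$: formulas $\xi::=\Diamond A\mid\xi\cap\xi\mid\xi\cup\xi$; structures $\Pi::=\xi\mid\circ X\mid\circledS\mid\Pi\cdot\Pi\mid\Pi\supset\Pi$. (The connectives $\cap,\cup,\circledS,\cdot,\supset$ of type $\mathsf{P}^{\mathrm{op}}$ carry a superscript $^{\mathrm{op}}$ which is suppressed.) A sequent $x\vdash y$ has $x,y$ structures of the same type. In $x\vdash y$, $x$ is in precedent position and $y$ in succedent position; substructures inherit the position of the parent, except that the first argument of $\supset$ has the opposite position. Only sequents are considered in which $\circ X$ of type $\mathsf{P}$ and $\bullet\Pi$ occur only in succedent position, and $\circ X$ of type $\mathsf{P}^{\mathrm{op}}$ and $\bullet\Gamma$ occur only in precedent position. **Rules of D.LL.** Notation: ''premises / conclusion''; ''//'' denotes a double-line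 rule, usable in both directions. $X,Y$ are $\mathsf{L}$-structures, $\Gamma$ a $\mathsf{P}$-structure, $\Pi$ a $\mathsf{P}^{\mathrm{op}}$-structure. In the pure-type rules $S,T,U,V$ are structures and $s,t$ formulas, all of the same type, which is either $\mathsf{P}$ or $\mathsf{P}^{\mathrm{op}}$. - Multi-type display rules: $\Gamma\vdash\circ X$ // $\bullet\Gamma\vdash X$; $\ \circ X\vdash\Pi$ // $X\vdash\bullet\Pi$. - Pure $\mathsf{P}$/$\mathsf{P}^{\mathrm{op}}$ display rules: $S\cdot T\vdash U$ // $T\vdash S\supset U$; $\ S\vdash T\cdot U$ // $T\supset S\vdash U$. - Pure $\mathsf{P}$/$\mathsf{P}^{\mathrm{op}}$ structural rules. Cut: $S\vdash s$, $s\vdash T$ / $S\vdash T$. Unit: $S\vdash T$ // $S\cdot\circledS\vdash T$; $S\vdash T$ // $S\vdash T\cdot\circledS$. Exchange: $S\cdot T\vdash U$ / $T\cdot S\vdash U$; $S\vdash T\cdot U$ / $S\vdash U\cdot T$. Associativity: $(S\cdot T)\cdot U\vdash V$ // $S\cdot(T\cdot U)\vdash V$; $S\vdash(T\cdot U)\cdot V$ // $S\vdash T\cdot(U\cdot V)$. Weakening: $S\vdash T$ / $S\cdot U\vdash T$; $S\vdash T$ / $S\vdash T\cdot U$. Contraction: $S\cdot S\vdash T$ / $S\vdash T$; $S\vdash T\cdot T$ / $S\vdash T$. - Pure $\mathsf{P}$/$\mathsf{P}^{\mathrm{op}}$ operational rules: $s\cdot t\vdash S$ / $s\cap t\vdash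 S$; $\ S\vdash s$, $T\vdash t$ / $S\cdot T\vdash s\cap t$; $\ s\vdash S$, $t\vdash T$ / $s\cup t\vdash S\cdot T$; $\ S\vdash s\cdot t$ / $S\vdash s\cup t$. - Pure $\mathsf{L}$ rules. Id: $p\vdash p$ (axiom, $p$ atomic). Cut: $X\vdash A$, $A\vdash Y$ / $X\vdash Y$. $\mathrm{I}$-weakening: $\mathrm{I}\vdash X$ / $Y\vdash X$; $X\vdash\mathrm{I}$ / $X\vdash Y$. Constants: $\mathrm{I}\vdash X$ / $\top\vdash X$; $\mathrm{I}\vdash\top$ (axiom); $\bot\vdash\mathrm{I}$ (axiom); $X\vdash\mathrm{I}$ / $X\vdash\bot$. - Operational rules for multi-type connectives: $\circ A\vdash\Pi$ / $\Diamond A\vdash\Pi$; $\ X\vdash A$ / $\circ X\vdash\Diamond A$ (type $\mathsf{P}^{\mathrm{op}}$); $\ X\vdash\bullet\xi$ / $X\vdash\blacksquare\xi$; $\ \xi\vdash\Pi$ / $\blacksquare\xi\vdash\bullet\Pi$; $\ \bullet\alpha\vdash X$ / $◆\alpha\vdash X$; $\ \Gamma\vdash\alpha$ / $\bullet\Gamma\vdash ◆\alpha$; $\ \Gamma\vdash\circ A$ / $\Gamma\vdash\Box A$; $\ A\vdash X$ / $\Box A\vdash\circ X$ (type $\mathsf{P}$). **Interpretation.** A sequent of type $\mathsf{L}$, $\mathsf{P}$, $\mathsf{P}^{\mathrm{op}}$ is interpreted as an inequality ($\vdash$ read as $\le$) in $\mathbb{L}$, $\mathbb{D}$, $\mathbb{E}$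 respectively. $\Box,\Diamond,◆,\blacksquare$ are interpreted as $e_\ell,e_r,\gamma,\iota$ respectively; $\top,\bot$ as the top and bottom of $\mathbb{L}$; $\cap,\cup$ as the meet and join of $\mathbb{D}$ (type $\mathsf{P}$) or of $\mathbb{E}$ (type $\mathsf{P}^{\mathrm{op}}$). Structural connectives: $\mathrm{I}$ is $\top$ in precedent and $\bot$ in succedent position; $\circledS$ is the top in precedent and the bottom in succedent position, of $\mathbb{D}$ or $\mathbb{E}$ according to type; $\cdot$ is meet in precedent and join in succedent position; $S\supset U$ in succedent position is the greatest $t$ with $S\wedge t\le U$, and $T\supset S$ in precedent position is the least $u$ with $S\le T\vee u$ (both computed in $\mathbb{D}$ or $\mathbb{E}$); $\circ X$ is $e_\ell(X)$ (type $\mathsf{P}$, succedent position) or $e_r(X)$ (type $\mathsf{P}^{\mathrm{op}}$, precedent position); $\bullet\Gamma$ is $\gamma(\Gamma)$ (precedent position) and $\bullet\Pi$ is $\iota(\Pi)$ (succedent position). *)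

(* Defs.v *)
From HB Require Import structures.
From mathcomp Require Import all_boot all_order.
From mathcomp Require Import boolp classical_sets.

Set Implicit Arguments.
Unset Strict Implicit.
Unset Printing Implicit Defensive.

Local Open Scope classical_set_scope.
Local Open Scope order_scope.

(** * Heterogeneous algebras *)

Definition complete_lattice d (T : tbLatticeType d) : Prop :=
  forall A : set T, supremums A !=set0 /\ infimums A !=set0.

(* The defaults \bot and \top are the values of [supremum] and [infimum] on
   the empty set, so that these are the join and the meet of every subset of a
   complete lattice.  Choice functions are dependent functions
   [forall j, K j]. *)
Definition completely_distributive d (T : tbLatticeType d) : Prop :=
  forall (J : Type) (K : J -> Type) (x : forall j, K j -> T),
    infimum \top (range (fun j => supremum \bot (range (x j)))) =
    supremum \bot
      (range (fun f : forall j, K j => infimum \top (range (fun j => x j (f j))))).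

Record hetAlg := HetAlg {
  dispL : Order.disp_t;
  dispD : Order.disp_t;
  dispE : Order.disp_t;
  algL : tbPOrderType dispL;
  algD : tbLatticeType dispD;
  algE : tbLatticeType dispE;
  el : algL -> algD;
  gam : algD -> algL;
  er : algL -> algE;
  iot : algE -> algL;
  algD_complete : complete_lattice algD;
  algD_distributive : completely_distributive algD;
  algE_complete : complete_lattice algE;
  algE_distributive : completely_distributive algE;
  gam_el_adjoint : forall (alpha : algD) (a : algL),
    (gam alpha <= a) = (alpha <= el a);
  gam_elK : cancel el gam;
  er_iot_adjoint : forall (a : algL) (xi : algE),
    (er a <= xi) = (a <= iot xi);
  iot_erK : cancel er iot
}.

(** * Language *)

(* [Pure Left] is the type P and [Pure Right] the type P^op. *)
Variant side := Left | Right.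
Variant type := Lat | Pure of side.

Variant position := Pre | Suc.
Definition opp (b : position) : position :=
  match b with Pre => Suc | Suc => Pre end.

(* The metavariables that occur in the rules, by type. *)
Variant fmeta : type -> Type :=
| mA : fmeta Lat
| malpha : fmeta (Pure Left)
| mxi : fmeta (Pure Right)
| ms d : fmeta (Pure d)
| mt d : fmeta (Pure d).

Variant smeta : type -> Type :=
| mX : smeta Lat
| mY : smeta Lat
| mGamma : smeta (Pure Left)
| mPi : smeta (Pure Right)
| mS d : smeta (Pure d)
| mT d : smeta (Pure d)
| mU d : smeta (Pure d)
| mV d : smeta (Pure d).

(* Formula schemes: the formulas are those without [FMeta]. *)
Inductive formula (AtProp : Type) : type -> Type :=
| FMeta t : fmeta t -> formula AtProp t
| Atom : AtProp -> formula AtProp Lat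
| Top : formula AtProp Lat
| Bot : formula AtProp Lat
| BlackDiamond : formula AtProp (Pure Left) -> formula AtProp Lat
| BlackBox : formula AtProp (Pure Right) -> formula AtProp Lat
| WhiteBox : formula AtProp Lat -> formula AtProp (Pure Left)
| WhiteDiamond : formula AtProp Lat -> formula AtProp (Pure Right)
| Cap d : formula AtProp (Pure d) -> formula AtProp (Pure d) ->
    formula AtProp (Pure d)
| Cup d : formula AtProp (Pure d) -> formula AtProp (Pure d) ->
    formula AtProp (Pure d).

(* Structure schemes (the structures are those without metavariables), indexed
   by the position in which they stand.  The index makes the sequents
   [precedent |- succedent] below exactly those in which [CircL] (the circle of
   type P) and [BulletPi] are in succedent position, [CircR] (the circle of
   type P^op) and [BulletGamma] in precedent position. *)
Inductive structure (AtProp : Type) : type -> position -> Type :=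
| SMeta t b : smeta t -> structure AtProp t b
| Form t b : formula AtProp t -> structure AtProp t b
| SI b : structure AtProp Lat b
| BulletGamma : structure AtProp (Pure Left) Pre -> structure AtProp Lat Pre
| BulletPi : structure AtProp (Pure Right) Suc -> structure AtProp Lat Suc
| CircL : structure AtProp Lat Suc -> structure AtProp (Pure Left) Suc
| CircR : structure AtProp Lat Pre -> structure AtProp (Pure Right) Pre
| CircledS d b : structure AtProp (Pure d) b
| Dot d b : structure AtProp (Pure d) b -> structure AtProp (Pure d) b ->
    structure AtProp (Pure d) b
| Supset d b : structure AtProp (Pure d) (opp b) -> structure AtProp (Pure d) b ->
    structure AtProp (Pure d) b.

Inductive sequent (AtProp : Type) : Type :=
| Sequent t : structure AtProp t Pre -> structure AtProp t Suc ->
    sequent AtProp.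

Arguments FMeta {AtProp t}.
Arguments Atom {AtProp}.
Arguments Top {AtProp}.
Arguments Bot {AtProp}.
Arguments SMeta {AtProp t b}.
Arguments Form {AtProp t b}.
Arguments SI {AtProp b}.
Arguments CircledS {AtProp d b}.
Arguments Supset {AtProp d b}.

(** * Rules *)

Declare Scope dll_scope.
Delimit Scope dll_scope with dll.
Notation "x ⊢ y" := (Sequent x y) (at level 70, no associativity) : dll_scope.
Notation "x ⊙ y" := (Dot x y) (at level 50, left associativity) : dll_scope.
Notation "x ⊃ y" := (Supset x y) (at level 50, no associativity) : dll_scope.

Module Metavariables.
Notation A := (FMeta mA) (only parsing).
Notation α := (FMeta malpha) (only parsing).
Notation ξ := (FMeta mxi) (only parsing).
Notation s d := (FMeta (ms d)) (only parsing).
Notation t d := (FMeta (mt d)) (only parsing).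
Notation X := (SMeta mX) (only parsing).
Notation Y := (SMeta mY) (only parsing).
Notation Γ := (SMeta mGamma) (only parsing).
Notation Π := (SMeta mPi) (only parsing).
Notation S d := (SMeta (mS d)) (only parsing).
Notation T d := (SMeta (mT d)) (only parsing).
Notation U d := (SMeta (mU d)) (only parsing).
Notation V d := (SMeta (mV d)) (only parsing).
End Metavariables.

Section Rules.
Import Metavariables.
Local Open Scope dll_scope.

Variant double_rule (AtProp : Type) : sequent AtProp -> sequent AtProp -> Prop :=
| display_adjL : double_rule (Γ ⊢ CircL X) (BulletGamma Γ ⊢ X)
| display_adjR : double_rule (CircR X ⊢ Π) (X ⊢ BulletPi Π)
| display_pre d : double_rule (S d ⊙ T d ⊢ U d) (T d ⊢ S d ⊃ U d)
| display_suc d : double_rule (S d ⊢ T d ⊙ U d) (T d ⊃ S d ⊢ U d)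
| unit_pre d : double_rule (S d ⊢ T d) (S d ⊙ CircledS ⊢ T d)
| unit_suc d : double_rule (S d ⊢ T d) (S d ⊢ T d ⊙ CircledS)
| assoc_pre d :
    double_rule ((S d ⊙ T d) ⊙ U d ⊢ V d) (S d ⊙ (T d ⊙ U d) ⊢ V d)
| assoc_suc d :
    double_rule (S d ⊢ (T d ⊙ U d) ⊙ V d) (S d ⊢ T d ⊙ (U d ⊙ V d)).

(* [dll_rule premises conclusion] *)
Variant dll_rule (AtProp : Type) : seq (sequent AtProp) -> sequent AtProp -> Prop :=
| double_down x y : double_rule x y -> dll_rule [:: x] y
| double_up x y : double_rule x y -> dll_rule [:: y] x
(* structural rules of types P and P^op *)
| cut_pure d : dll_rule [:: S d ⊢ Form (s d); Form (s d) ⊢ T d] (S d ⊢ T d)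
| exchange_pre d : dll_rule [:: S d ⊙ T d ⊢ U d] (T d ⊙ S d ⊢ U d)
| exchange_suc d : dll_rule [:: S d ⊢ T d ⊙ U d] (S d ⊢ U d ⊙ T d)
| weakening_pre d : dll_rule [:: S d ⊢ T d] (S d ⊙ U d ⊢ T d)
| weakening_suc d : dll_rule [:: S d ⊢ T d] (S d ⊢ T d ⊙ U d)
| contraction_pre d : dll_rule [:: S d ⊙ S d ⊢ T d] (S d ⊢ T d)
| contraction_suc d : dll_rule [:: S d ⊢ T d ⊙ T d] (S d ⊢ T d)
(* operational rules of types P and P^op *)
| cap_pre d :
    dll_rule [:: Form (s d) ⊙ Form (t d) ⊢ S d] (Form (Cap (s d) (t d)) ⊢ S d)
| cap_suc d :
    dll_rule [:: S d ⊢ Form (s d); T d ⊢ Form (t d)]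
             (S d ⊙ T d ⊢ Form (Cap (s d) (t d)))
| cup_pre d :
    dll_rule [:: Form (s d) ⊢ S d; Form (t d) ⊢ T d]
             (Form (Cup (s d) (t d)) ⊢ S d ⊙ T d)
| cup_suc d :
    dll_rule [:: S d ⊢ Form (s d) ⊙ Form (t d)] (S d ⊢ Form (Cup (s d) (t d)))
(* rules of type L *)
| id_atom (p : AtProp) : dll_rule [::] (Form (Atom p) ⊢ Form (Atom p))
| cut_L : dll_rule [:: X ⊢ Form A; Form A ⊢ Y] (X ⊢ Y)
| I_weakening_pre : dll_rule [:: SI ⊢ X] (Y ⊢ X)
| I_weakening_suc : dll_rule [:: X ⊢ SI] (X ⊢ Y)
| top_pre : dll_rule [:: SI ⊢ X] (Form Top ⊢ X)
| top_suc : dll_rule [::] (SI ⊢ Form Top)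
| bot_pre : dll_rule [::] (Form Bot ⊢ SI)
| bot_suc : dll_rule [:: X ⊢ SI] (X ⊢ Form Bot)
(* operational rules for the multi-type connectives *)
| white_diamond_pre :
    dll_rule [:: CircR (Form A) ⊢ Π] (Form (WhiteDiamond A) ⊢ Π)
| white_diamond_suc :
    dll_rule [:: X ⊢ Form A] (CircR X ⊢ Form (WhiteDiamond A))
| black_box_suc :
    dll_rule [:: X ⊢ BulletPi (Form ξ)] (X ⊢ Form (BlackBox ξ))
| black_box_pre :
    dll_rule [:: Form ξ ⊢ Π] (Form (BlackBox ξ) ⊢ BulletPi Π)
| black_diamond_pre :
    dll_rule [:: BulletGamma (Form α) ⊢ X] (Form (BlackDiamond α) ⊢ X)
| black_diamond_suc :
    dll_rule [:: Γ ⊢ Form α] (BulletGamma Γ ⊢ Form (BlackDiamond α))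
| white_box_suc :
    dll_rule [:: Γ ⊢ CircL (Form A)] (Γ ⊢ Form (WhiteBox A))
| white_box_pre :
    dll_rule [:: Form A ⊢ X] (Form (WhiteBox A) ⊢ CircL X).

End Rules.

(** * Interpretation *)

Definition disp_pure (H : hetAlg) (d : side) : Order.disp_t :=
  match d with Left => dispD H | Right => dispE H end.

Definition alg_pure (H : hetAlg) (d : side) : tbLatticeType (disp_pure H d) :=
  match d with Left => algD H | Right => algE H end.

Definition disp_of (H : hetAlg) (t : type) : Order.disp_t :=
  match t with Lat => dispL H | Pure d => disp_pure H d end.

Definition alg_of (H : hetAlg) (t : type) : tbPOrderType (disp_of H t) :=
  match t with Lat => algL H | Pure d => alg_pure H d end.

(* [greatest A] and [least A] are the greatest and the least element of [A] if
   there is one, and a junk value otherwise.  In the sets to which they are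
   applied below one always exists, by complete distributivity. *)
Definition greatest d (T : tbLatticeType d) (A : set T) : T :=
  xget \bot (A `&` ubound A)%classic.

Definition least d (T : tbLatticeType d) (A : set T) : T :=
  xget \top (A `&` lbound A)%classic.

Record assignment (AtProp : Type) (H : hetAlg) := Assignment {
  val_atom : AtProp -> algL H;
  val_fmeta : forall t, fmeta t -> alg_of H t;
  val_smeta : forall t, smeta t -> alg_of H t
}.

Fixpoint interp_formula AtProp H (v : assignment AtProp H) t
    (x : formula AtProp t) : alg_of H t :=
  match x in formula _ t return alg_of H t with
  | FMeta _ m => val_fmeta v m
  | Atom p => val_atom v p
  | Top => (\top : algL H)
  | Bot => (\bot : algL H)
  | BlackDiamond alpha => @gam H (interp_formula v alpha)
  | BlackBox xi => @iot H (interp_formula v xi)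
  | WhiteBox a => @el H (interp_formula v a)
  | WhiteDiamond a => @er H (interp_formula v a)
  | Cap d x y =>
      (interp_formula v x : alg_pure H d) `&` (interp_formula v y : alg_pure H d)
  | Cup d x y =>
      (interp_formula v x : alg_pure H d) `|` (interp_formula v y : alg_pure H d)
  end.

Definition interp_I H (b : position) : algL H :=
  match b with Pre => \top | Suc => \bot end.

Definition interp_S H d (b : position) : alg_pure H d :=
  match b with Pre => \top | Suc => \bot end.

Definition interp_dot H d (b : position) (x y : alg_pure H d) : alg_pure H d :=
  match b with Pre => x `&` y | Suc => x `|` y end.

Definition interp_supset H d (b : position) (x y : alg_pure H d) : alg_pure H d :=
  match b with
  | Suc => greatest [set z | x `&` z <= y]
  | Pre => least [set z | y <= x `|` z]
  end.

Fixpoint interp_structure AtProp H (v : assignment AtProp H) t b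
    (x : structure AtProp t b) : alg_of H t :=
  match x in structure _ t b return alg_of H t with
  | SMeta _ _ m => val_smeta v m
  | Form _ _ a => interp_formula v a
  | SI b => interp_I H b
  | BulletGamma g => @gam H (interp_structure v g)
  | BulletPi p => @iot H (interp_structure v p)
  | CircL x => @el H (interp_structure v x)
  | CircR x => @er H (interp_structure v x)
  | CircledS d b => interp_S H d b
  | Dot d b x y =>
      @interp_dot H d b (interp_structure v x) (interp_structure v y)
  | Supset d b x y =>
      @interp_supset H d b (interp_structure v x) (interp_structure v y)
  end.

Definition holds AtProp H (v : assignment AtProp H) (x : sequent AtProp) : Prop :=
  match x with
  | Sequent _ l r => interp_structure v l <= interp_structure v r
  end.

(* Main.v *)
Require Import Defs.
From Stdlib Require Import List.
From mathcomp Require Import all_boot all_order.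
From mathcomp Require Import boolp classical_sets.

(** Under the interpretation each rule becomes a fact about ordered sets. The
    structural and operational rules are the lattice laws, the transitivity of
    the order and the bounds; the rules that put a multi-type connective on one
    side of a sequent and its structural counterpart on the other say that the
    four maps are monotone ([el_homo], [gam_homo], [er_homo], [iot_homo]); the
    multi-type display rules are the two adjunctions.

    The display rules for [⊃] need more: that the greatest [z] with
    [x `&` z <= y] and the least [z] with [y <= x `|` z] exist. In a complete
    lattice they do as soon as a binary meet distributes over arbitrary joins
    ([meet_supremum_le]) and a binary join over arbitrary meets
    ([le_join_infimum]), because then the join of all the [z] in question, or
    their meet, is itself one of them. Both laws are instances of complete
    distributivity, with index families in which either the outer or the inner
    index set has two elements. *)

Import Order.TTheory.
Local Open Scope classical_set_scope.
Local Open Scope order_scope.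

Section CompleteLattice.
Context {d : Order.disp_t} {T : tbLatticeType d} (cT : complete_lattice T).
Implicit Types (A : set T) (x y z : T).

(** [supremum] of the empty set is its default value, which is the least upper
    bound there only because it is the bottom. *)
Lemma supremumP A : supremums A (supremum \bot A).
Proof.
rewrite /supremum; case: ifPn => [/eqP ->|_]; last first.
  by apply: xgetPex; have [] := cT A.
by split=> [x []|x _]; rewrite ?le0x.
Qed.

Lemma infimumP A : infimums A (infimum \top A).
Proof.
rewrite /infimum; case: ifPn => [/eqP ->|_]; last first.
  by apply: xgetPex; have [] := cT A.
by split=> [x []|x _]; rewrite ?lex1.
Qed.

End CompleteLattice.

Section Residuation.
Context {d : Order.disp_t} {T : tbLatticeType d}.
Hypotheses (cT : complete_lattice T) (cdT : completely_distributive T).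
Implicit Types (A : set T) (x y z : T).

(** Complete distributivity for the two families [{x}] and [A]: a choice function
    for them is just an element of [A], so the right-hand side of the law is the
    join of the [x `&` a]. *)
Lemma meet_supremum_le A x y :
  (forall a, A a -> x `&` a <= y) -> x `&` supremum \bot A <= y.
Proof.
move=> xAy.
pose K (b : bool) : Type := if b return Type then unit else {a | A a}.
pose g (b : bool) : K b -> T :=
  if b return K b -> T then fun=> x else fun a => sval a.
have dist := cdT bool K g.
apply: (@le_trans _ _ (infimum \top (range (fun b => supremum \bot (range (g b)))))).
  apply: (infimumP cT _).2 => _ [[] _ <-].
    apply: (le_trans (leIl _ _)); apply: (supremumP cT _).1; by exists tt.
  apply: (le_trans (leIr _ _)); apply: (supremumP cT _).2 => a Aa.
  apply: (supremumP cT _).1; by exists (exist _ a Aa).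
rewrite dist; apply: (supremumP cT _).2 => _ [f _ <-].
apply: le_trans (xAy _ (svalP (f false))).
by rewrite lexI; apply/andP; split; apply: (infimumP cT _).1;
  [exists true | exists false].
Qed.

(** Complete distributivity for the families [{x, a}], one for each [a] in [A],
    whose joins [x `|` a] are all above [y]. A choice function either picks [x] at least
    once, and then the meet of its values is below [x], or it picks every [a],
    and then that meet is the meet of [A]. *)
Lemma le_join_infimum A x y :
  (forall a, A a -> y <= x `|` a) -> y <= x `|` infimum \top A.
Proof.
move=> yxA.
pose g (a : {a | A a}) (b : bool) : T := if b then x else sval a.
have dist := cdT {a | A a} (fun=> bool) g.
apply: (@le_trans _ _ (infimum \top (range (fun a => supremum \bot (range (g a)))))).
  apply: (infimumP cT _).2 => _ [a _ <-].
  apply: (le_trans (yxA _ (svalP a))).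
  by rewrite leUx; apply/andP; split; apply: (supremumP cT _).1;
    [exists true | exists false].
rewrite dist; apply: (supremumP cT _).2 => _ [f _ <-].
have [[a fa]|nf] := pselect (exists a, f a).
  apply: le_trans (leUl _ _); apply: (infimumP cT _).1.
  by exists a => //; rewrite /g fa.
apply: le_trans (leUr _ _); apply: (infimumP cT _).2 => a Aa.
apply: (infimumP cT _).1; exists (exist _ a Aa) => //.
by rewrite /g; case: ifP => // fa; case: nf; exists (exist _ a Aa).
Qed.

(** Residuation: [x `&` -] is left adjoint to Heyting implication by [x]. *)
Lemma le_greatest x y z :
  (z <= greatest [set t | x `&` t <= y]) = (x `&` z <= y).
Proof.
set A := [set t | _].
have [Ag ubg] : (A `&` ubound A) (greatest A).
  apply: xgetPex; exists (supremum \bot A); split.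
    exact: meet_supremum_le.
  exact: (supremumP cT A).1.
by apply/idP/idP => [zg|/ubg//]; apply: le_trans (leI2 (lexx x) zg) Ag.
Qed.

(** Dual residuation: [x `|` -] is right adjoint to co-implication by [x]. *)
Lemma least_le x y z :
  (least [set t | y <= x `|` t] <= z) = (y <= x `|` z).
Proof.
set A := [set t | _].
have [Al lbl] : (A `&` lbound A) (least A).
  apply: xgetPex; exists (infimum \top A); split.
    exact: le_join_infimum.
  exact: (infimumP cT A).1.
by apply/idP/idP => [lz|/lbl//]; apply: (le_trans Al); apply: leU2.
Qed.

End Residuation.

Lemma alg_pure_complete (H : hetAlg) d : complete_lattice (alg_pure H d).
Proof. by case: d; [apply: algD_complete | apply: algE_complete]. Qed.

Lemma alg_pure_distributive (H : hetAlg) d :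
  completely_distributive (alg_pure H d).
Proof. by case: d; [apply: algD_distributive | apply: algE_distributive]. Qed.

(** An equality of propositions covers both directions of a double-line rule. *)
Lemma double_rule_sound {AtProp : Type} {x y : sequent AtProp} (H : hetAlg)
  (v : assignment AtProp H) : double_rule x y -> holds v x = holds v y.
Proof.
case=> [||d|d|d|d|d|d] /=.
- by rewrite gam_el_adjoint.
- by rewrite er_iot_adjoint.
- by rewrite (le_greatest (alg_pure_complete H d) (alg_pure_distributive H d)).
- by rewrite (least_le (alg_pure_complete H d) (alg_pure_distributive H d)).
- by rewrite (@meetx1 _ (alg_pure H d)).
- by rewrite (@joinx0 _ (alg_pure H d)).
- by rewrite (@meetA _ (alg_pure H d)).
- by rewrite (@joinA _ (alg_pure H d)).
Qed.

Lemma el_homo (H : hetAlg) : {homo @el H : a b / a <= b}.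
Proof. by move=> a b ab; rewrite -gam_el_adjoint gam_elK. Qed.

Lemma gam_homo (H : hetAlg) : {homo @gam H : a b / a <= b}.
Proof.
by move=> a b ab; rewrite gam_el_adjoint (le_trans ab)// -gam_el_adjoint.
Qed.

Lemma er_homo (H : hetAlg) : {homo @er H : a b / a <= b}.
Proof. by move=> a b ab; rewrite er_iot_adjoint iot_erK. Qed.

Lemma iot_homo (H : hetAlg) : {homo @iot H : a b / a <= b}.
Proof.
by move=> a b ab; rewrite -er_iot_adjoint (le_trans _ ab)// er_iot_adjoint.
Qed.

Theorem mainTheorem1 (AtProp : Type) (premises : list (sequent AtProp))
    (conclusion : sequent AtProp)
    (rule : dll_rule premises conclusion)
    (H : hetAlg) (v : assignment AtProp H) :
  (forall x : sequent AtProp, In x premises -> holds v x) ->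
  holds v conclusion.
Proof.
case: rule => [x y xy|x y xy|d|d|d|d|d|d|d|d|d|d|d|p|||||||||||||||] prem.
- by rewrite -(double_rule_sound H v xy); apply: prem; left.
- by rewrite (double_rule_sound H v xy); apply: prem; left.
(* A remaining rule has at most two premises; they go in front of the goal in
   their order. *)
all: try (have /= := prem _ (or_intror (or_introl erefl))).
all: try (have /= := prem _ (or_introl erefl)).
(* This closes the rules that only restate their premise: those that turn a
   structural connective into the operational one with the same
   interpretation. The axioms hold by reflexivity. *)
all: clear prem; rewrite /= ?lexx //.
- exact: le_trans.
- by rewrite (@meetC _ (alg_pure H d)).
- by rewrite (@joinC _ (alg_pure H d)).
- exact: (@leIxl _ (alg_pure H d)).
- exact: (@lexUl _ (alg_pure H d)).
- by rewrite (@meetxx _ (alg_pure H d)).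
- by rewrite (@joinxx _ (alg_pure H d)).
- exact: (@leI2 _ (alg_pure H d)).
- exact: (@leU2 _ (alg_pure H d)).
- exact: le_trans.
- exact/le_trans/lex1.
- by move/le_trans; apply; apply: le0x.
- exact: er_homo.
- exact: iot_homo.
- exact: gam_homo.
- exact: el_homo.
Qed.
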